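(* Let $(p_{ij}\colon(X_j,\nu_j)\to(X_i,\nu_i))_{i\sqsubseteq j\in I}$ be a projective system of valued spaces, and let $X,(p_i)_{i\in I}$ be a projective limit, in the category of topological spaces, of the underlying projective system $(p_{ij}\colon X_j\to X_i)_{i\sqsubseteq j\in I}$. If $I$ has a countable cofinal subset, if every $\nu_i$ is locally finite, and if every $X_i$ embeds (as a topological subspace) as a $G_\delta$ subset in a locally compact sober space, then there is a unique continuous valuation $\nu$ on $X$ such that $\nu_i=p_i[\nu]$ for every $i\in I$. Moreover, $\nu$ is tight.
   Context: For a topological space $X$, $\mathcal O X$ is its lattice of open subsets, and $\overline{\mathbb R}_+=[0,\infty]$. A valuation on $X$ is a map $\nu\colon\mathcal O X\to\overline{\mathbb R}_+$ with $\nu(\emptyset)=0$, $U\subseteq V\Rightarrow\nu(U)\le\nu(V)$, and $\nu(U\cup V)+\nu(U\cap V)=\nu(U)+\nu(V)$. It is continuous if it preserves suprema of directed families of open sets, and locally finite if every point $x\in X$ has an open neighborhood $U$ with $\nu(U)<\infty$. For $f\colon X\to Y$ continuous, $f[\nu](V)=\nu(f^{-1}(V))$ for $V\in\mathcal O Y$. A projective system of valued spaces $(p_{ij}\colon(X_j,\nu_j)\to(X_i,\nu_i))_{i\sqsubseteq j\in I}$ consists of a directed preordered set $(I,\sqsubseteq)$, topological spaces $X_i$ with continuous valuations $\nu_i$ ($i\in I$), and continuous maps $p_{ij}\colon X_j\to X_i$ for $i\sqsubseteq j$, with $p_{ii}=\mathrm{id}$, $p_{ij}\circ p_{jk}=p_{ik}$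 for $i\sqsubseteq j\sqsubseteq k$, and $p_{ij}[\nu_j]=\nu_i$ for $i\sqsubseteq j$. A projective limit of the underlying system of spaces is its limit in the category of topological spaces; up to isomorphism it is the subspace $\{\vec x\in\prod_i X_i\mid x_i=p_{ij}(x_j)\ \forall i\sqsubseteq j\}$ of the product, with $p_i(\vec x)=x_i$. A set is saturated iff it is an intersection of open sets; a $G_\delta$ subset is a countable intersection of open sets. Compactness does not include Hausdorffness. A space is locally compact if every open subset $U$ is the directed union of the interiors of the compact saturated subsets of $U$. A space is sober if it is $T_0$ and every irreducible closed subset is the closure of a point. For a map $\nu\colon\mathcal O X\to\overline{\mathbb R}_+$ and $Q\subseteq X$ compact saturated, $\nu^\bullet(Q)=\inf\{\nu(U)\mid U \text{ open},\,Q\subseteq U\}$. For $r,s\in\overline{\mathbb R}_+$, $r\ll s$ iff $r=0$ or $r<s$. The map $\nu$ is tight if for every open $U$ and every $r\ll\nu(U)$ there is a compact saturated $Q\subseteq U$ with $r\le\nu^\bullet(Q)$. *)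

(* Defs.v *)
From HB Require Import structures.
From mathcomp Require Import all_boot all_order all_algebra.
From mathcomp Require Import all_classical all_reals all_analysis borel_hierarchy.

Set Implicit Arguments.
Unset Strict Implicit.
Unset Printing Implicit Defensive.

Import Order.TTheory GRing.Theory Num.Theory.

Local Open Scope classical_set_scope.

(* Directed sets are required to be nonempty. *)
Definition directed (T : Type) (le : T -> T -> Prop) (D : set T) : Prop :=
  D !=set0 /\
  forall x y, D x -> D y -> exists2 z, D z & le x z /\ le y z.

Section Spaces.
Context {T : topologicalType}.

Definition saturated (A : set T) : Prop :=
  exists2 F : set (set T), F `<=` open & A = \bigcap_(U in F) U.

Definition compact_saturated (Q : set T) : Prop := compact Q /\ saturated Q.

Definition irreducible_closed (C : set T) : Prop :=
  [/\ closed C, C !=set0 &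
      forall A B, closed A -> closed B -> C `<=` A `|` B ->
        C `<=` A \/ C `<=` B].

End Spaces.

(* No separation axiom is assumed here; [locally_compact] from the library asks
   for closed compact neighbourhoods and is a different notion. *)
Definition locally_compact_space (T : topologicalType) : Prop :=
  forall U : set T, open U ->
    let F := [set Q° | Q in [set Q | compact_saturated Q /\ Q `<=` U]] in
    directed (@subset T) F /\ U = \bigcup_(V in F) V.

Definition sober_space (T : topologicalType) : Prop :=
  kolmogorov_space T /\
  forall C : set T, irreducible_closed C -> exists x, C = closure [set x].

Definition topological_embedding (S T : topologicalType) (f : S -> T) : Prop :=
  injective f /\
  forall U : set S, open U <-> exists2 V : set T, open V & U = f @^-1` V.

Definition embeds_as_Gdelta (S : topologicalType) : Prop :=
  exists (T : topologicalType) (f : S -> T),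
    [/\ locally_compact_space T, sober_space T,
        topological_embedding f & Gdelta (range f)].

Section Valuations.
Context {R : realType} {T : topologicalType}.
Local Open Scope ereal_scope.

(* A map from the lattice of open sets to [0, +oo] is represented by a total
   function [set T -> \bar R]; its values outside the open sets are irrelevant,
   and equality of such maps means agreement on the open sets. *)
Implicit Type nu : set T -> \bar R.

Definition valuation nu : Prop :=
  [/\ forall U, open U -> 0 <= nu U,
      nu set0 = 0,
      forall U V, open U -> open V -> U `<=` V -> nu U <= nu V &
      forall U V, open U -> open V ->
        nu (U `|` V) + nu (U `&` V) = nu U + nu V].

Definition continuous_valuation nu : Prop :=
  valuation nu /\
  forall F : set (set T), F `<=` open -> directed (@subset T) F ->
    nu (\bigcup_(U in F) U) = ereal_sup [set nu U | U in F].

Definition locally_finite nu : Prop :=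
  forall x : T, exists U, [/\ open U, U x & nu U < +oo].

Definition eq_on_open nu nu' : Prop := forall U, open U -> nu U = nu' U.

Definition outer_value nu (Q : set T) : \bar R :=
  ereal_inf [set nu U | U in [set U | open U /\ Q `<=` U]].

Definition way_below (r s : \bar R) : Prop := r = 0 \/ r < s.

Definition tight nu : Prop :=
  forall U, open U -> forall r, 0 <= r -> way_below r (nu U) ->
    exists Q, [/\ compact_saturated Q, Q `<=` U & r <= outer_value nu Q].

End Valuations.

Definition image_valuation (R : realType) (S T : topologicalType) (f : S -> T)
  (nu : set S -> \bar R) : set T -> \bar R := fun V => nu (f @^-1` V).

(* The bonding maps take the comparison [i <= j] as an argument: a total family
   [X j -> X i] would be too strong a requirement, since [X i] may be empty. *)
Record projective_system (d : Order.disp_t) (I : preorderType d) := {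
  ps_space :> I -> topologicalType;
  ps_map : forall i j : I, (i <= j)%O -> ps_space j -> ps_space i;
  ps_directed : directed (fun i j : I => (i <= j)%O : Prop) [set: I];
  ps_continuous : forall (i j : I) (ij : (i <= j)%O), continuous (ps_map ij);
  ps_map_id : forall (i : I) (ii : (i <= i)%O) (x : ps_space i),
    ps_map ii x = x;
  ps_map_comp : forall (i j k : I) (ij : (i <= j)%O) (jk : (j <= k)%O)
      (ik : (i <= k)%O) (x : ps_space k),
    ps_map ij (ps_map jk x) = ps_map ik x }.

Section ProjectiveSystems.
Context {d : Order.disp_t} {I : preorderType d}.
Variable X : projective_system I.

(* The valuations that turn [X] into a projective system of valued spaces. *)
Definition valued_system (R : realType) (nu : forall i, set (X i) -> \bar R)
    : Prop :=
  (forall i, continuous_valuation (nu i)) /\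
  forall (i j : I) (ij : (i <= j)%O),
    eq_on_open (image_valuation (ps_map ij) (nu j)) (nu i).

Definition projective_cone (Z : topologicalType) (q : forall i, Z -> X i)
    : Prop :=
  (forall i, continuous (q i)) /\
  forall (i j : I) (ij : (i <= j)%O) (z : Z), ps_map ij (q j z) = q i z.

Definition projective_limit (L : topologicalType) (p : forall i, L -> X i)
    : Prop :=
  projective_cone p /\
  forall (Z : topologicalType) (q : forall i, Z -> X i), projective_cone q ->
    exists! h : Z -> L, continuous h /\ forall i z, p i (h z) = q i z.

End ProjectiveSystems.

Definition has_countable_cofinal (d : Order.disp_t) (I : preorderType d)
    : Prop :=
  exists2 J : set I, countable J & forall i, exists2 j, J j & (i <= j)%O.

(* Main.v *)
(* By continuity the valuation of an open set U of the limit must be the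
   supremum of nu_n(U_n) along a cofinal sequence, where U_n is the largest open
   set of X_n whose preimage lies in U.  That this formula works hinges on
   tightness.  If r < nu_N(V), one chooses by diagonalisation, in the ambient
   locally compact spaces, decreasing sequences of open sets interpolated by
   compact saturated sets; at each stage finitely many coordinates are shrunk, and
   their common pullback to one late X_n keeps valuation > r.  The intersections
   are compact saturated sets Q_n inside the X_n with p(Q_n+1) inside Q_n, and
   every open neighbourhood of Q_n has valuation > r.  Steenrod's theorem for
   sober spaces then says that the threads of (Q_n) form a compact set Q, and that
   an increasing open cover of Q already covers some Q_n. *)

Require Import Defs.
From HB Require Import structures.
From mathcomp Require Import all_boot all_order all_algebra.
From mathcomp Require Import all_classical all_reals all_analysis.
From mathcomp Require Import borel_hierarchy.

Set Implicit Arguments.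
Unset Strict Implicit.
Unset Printing Implicit Defensive.

Import Order.TTheory.

Local Open Scope classical_set_scope.

(** * Compactness, closures of points and saturation *)

(** If no member of [D] covers [Q], the sets [Q] minus [U] generate a proper filter whose cluster
    point in [Q] escapes every [U] in [D]. Conversely, if [F] has no cluster point in [Q], the open
    sets whose complement belongs to [F] form a directed cover of [Q]. *)
Lemma compact_directedP (T : topologicalType) (Q : set T) :
  compact Q <->
  forall D : set (set T), D `<=` open -> directed (@subset T) D ->
    Q `<=` \bigcup_(U in D) U -> exists2 U, D U & Q `<=` U.
Proof.
split=> [cQ D Dop [[U0 DU0] Ddir] QD|H F FF FQ].
  apply: contrapT => noU.
  have FF : ProperFilter (filter_from D (fun U => Q `\` U)).
    apply: filter_from_proper; first apply: filter_from_filter.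
    - by exists U0.
    - move=> U V DU DV; have [W DW [UW VW]] := Ddir _ _ DU DV.
      by exists W => // x [Qx nWx]; split; split=> // ?; apply: nWx; auto.
    - move=> U DU; apply: contrapT => /set0P/negP/negPn/eqP UQ.
      by apply: noU; exists U => //; apply/subsets_disjoint; rewrite -setDE.
  have [|x [Qx Fx]] := cQ _ FF; first by exists U0 => // x [].
  have [U DU Ux] := QD _ Qx.
  have FU : filter_from D (fun U => Q `\` U) (Q `\` U) by exists U.
  by have [y [[_]]] := Fx _ _ FU (open_nbhs_nbhs (conj (Dop _ DU) Ux)).
pose D : set (set T) := [set U | open U /\ F (~` U)].
apply: contrapT => Qc; have [|||U [_ FU] QU] := H D.
- by move=> ? [].
- split.
    by exists set0; split; [exact: open0|rewrite setC0; exact: filterT].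
  move=> U V [oU FU] [oV FV]; exists (U `|` V); last by split=> x; [left|right].
  by split; [exact: openU|rewrite setCU; exact: filterI].
- move=> x Qx; apply: contrapT => nD; apply: Qc; exists x; split=> // A B FA.
  rewrite nbhsE => -[V [oV Vx] VB]; apply: contrapT => AB; apply: nD.
  exists V => //; split=> //; apply: filterS FA => y Ay Vy.
  by apply: AB; exists y; split=> //; exact: VB.
- apply: (@filter_not_empty _ F); apply: filterS (filterI FQ FU) => x [Qx].
  by apply; exact: QU.
Qed.

(** The complements of a chain form a directed family of open sets, none of which covers [Q]. *)
Lemma compact_chain_closed (T : topologicalType) (Q : set T) (J : Type)
    (A : set J) (C : J -> set T) :
  compact Q -> A !=set0 ->
  (forall i j, A i -> A j -> C i `<=` C j \/ C j `<=` C i) ->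
  (forall i, A i -> closed (C i)) -> (forall i, A i -> C i `&` Q !=set0) ->
  (\bigcap_(i in A) C i) `&` Q !=set0.
Proof.
move=> /compact_directedP cQ [i0 Ai0] chain Cc CQ; apply: contrapT => nC.
have [|||U [i Ai <-] QU] := cQ [set ~` C i | i in A].
- by move=> _ [i Ai <-]; apply: closed_openC; exact: Cc.
- split; first by exists (~` C i0), i0.
  move=> _ _ [i Ai <-] [j Aj <-]; have [ij|ji] := chain _ _ Ai Aj.
    by exists (~` C i); [exists i|split=> //; exact: subsetC].
  by exists (~` C j); [exists j|split=> //; exact: subsetC].
- move=> x Qx; apply: contrapT => nx; apply: nC; exists x; split=> // i Ai.
  by apply: contrapT => nCx; apply: nx; exists (~` C i) => //; exists i.
- by have [x [Cx Qx]] := CQ _ Ai; exact: QU Cx.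
Qed.

Lemma closure_set1P (T : topologicalType) (x y : T) :
  closure [set x] y <-> forall U, open U -> U y -> U x.
Proof.
split=> [xy U oU Uy|H B].
  by have [_ [->]] := xy _ (open_nbhs_nbhs (conj oU Uy)).
rewrite nbhsE => -[V [oV Vy] VB].
by exists x; split=> //; exact: VB (H _ oV Vy).
Qed.

Lemma closure_sub_closed (T : topologicalType) (A C : set T) :
  closed C -> A `<=` C -> closure A `<=` C.
Proof. by move=> cC AC; rewrite (closure_id C).1//; exact: closureS. Qed.

Lemma closure_set1_image (S T : topologicalType) (f : S -> T) (x y : S) :
  continuous f -> closure [set x] y -> closure [set f x] (f y).
Proof.
move=> fc /closure_set1P xy; apply/closure_set1P => U oU Ufy.
by apply: (xy (f @^-1` U)) => //; apply: open_comp => // ? _; exact: fc.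
Qed.

Lemma kolmogorov_eq (T : topologicalType) (x y : T) : kolmogorov_space T ->
  closure [set x] y -> closure [set y] x -> x = y.
Proof.
move=> T0 /closure_set1P xy /closure_set1P yx; apply: contrapT => /eqP/T0[A].
have oA : open A° by exact: open_interior.
case=> -[]; rewrite !inE => nA; apply.
  exact/(@interior_subset _ A)/(yx _ oA).
exact/(@interior_subset _ A)/(xy _ oA).
Qed.

Lemma saturated_specialization (T : topologicalType) (Q : set T) (x y : T) :
  saturated Q -> closure [set x] y -> Q y -> Q x.
Proof.
move=> [F Fo ->] /closure_set1P xy Qy U FU.
by apply: (xy U); [exact: Fo|exact: Qy].
Qed.

(** * Steenrod's theorem *)

Section Cylinders.
Context {d : Order.disp_t} {I : preorderType d}.
Variable X : projective_system I.

(* The quantification over proofs of [i <= j] makes this the whole space when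
   [i <= j] fails. *)
Definition cylinder (i j : I) (A : set (X i)) : set (X j) :=
  [set x | forall ij : (i <= j)%O, A (ps_map ij x)].

Lemma cylinderE i j (ij : (i <= j)%O) (A : set (X i)) :
  cylinder A = ps_map ij @^-1` A.
Proof.
apply/seteqP; split=> x; first exact.
by move=> /= Ax ij'; rewrite (bool_irrelevance ij' ij).
Qed.

Lemma cylinderT i j (A : set (X i)) : ~ (i <= j)%O -> cylinder A = [set: X j].
Proof. by move=> ij; apply/seteqP; split=> // x _ ij'; case: (ij ij'). Qed.

Lemma open_cylinder i j (A : set (X i)) : open A -> open (@cylinder i j A).
Proof.
move=> oA; have [ij|ij] := pselect (i <= j)%O; last first.
  by rewrite cylinderT //; exact: openT.
by rewrite cylinderE; apply: open_comp => // ? _; exact: ps_continuous.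
Qed.

Lemma closed_cylinder i j (A : set (X i)) :
  closed A -> closed (@cylinder i j A).
Proof.
move=> cA; have [ij|ij] := pselect (i <= j)%O; last first.
  by rewrite cylinderT //; exact: closedT.
by rewrite cylinderE; apply: closed_comp => // ? _; exact: ps_continuous.
Qed.

End Cylinders.

Section Steenrod.
Variable X : projective_system nat.
Variable Q : forall n, set (X n).
Arguments Q : clear implicits.
Hypothesis Qcs : forall n, compact_saturated (Q n).
Hypothesis Qmap : forall m n (mn : (m <= n)%O) x, Q n x -> Q m (ps_map mn x).

(** The traces of the [C n] on the [Q n] are nonempty, relatively closed, and form a subsystem. *)
Let family (C : forall n, set (X n)) : Prop :=
  [/\ forall n, closed (C n), forall n, C n `&` Q n !=set0 &
      forall m n (mn : (m <= n)%O) x, C n x -> Q n x -> C m (ps_map mn x)].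

Let minimal_family C := family C /\
  forall C', family C' -> (forall n, C' n `<=` C n) ->
  forall n, C n `<=` C' n.

(** Zorn's lemma for reverse inclusion: by compactness of [Q n], the componentwise intersection of a
    chain still meets every [Q n]. *)
Lemma exists_minimal_family C0 : family C0 ->
  exists C, minimal_family C /\ forall n, C n `<=` C0 n.
Proof.
move=> fC0; pose T := {C | family C /\ forall n, C n `<=` C0 n}.
pose t0 : T := exist _ C0 (conj fC0 (fun n => @subset_refl _ (C0 n))).
pose le (s t : T) : bool := `[< forall n, sval t n `<=` sval s n >].
have [||A Atot|[C [fC CC0]] Cmin] := @ZL_preorder T t0 le.
- by move=> t; apply/asboolP => n.
- move=> r s t /asboolP sr /asboolP ts; apply/asboolP => n.
  exact: subset_trans (ts n) (sr n).
- have [[s0 As0]|A0] := pselect (A !=set0); last first.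
    by exists t0 => s As; exfalso; apply: A0; exists s.
  pose C n := \bigcap_(s in A) sval s n.
  have fC : family C.
    split=> [n|n|m n mn x Cx Qx s As].
    - by apply: closed_bigI => s _; have [[]] := svalP s.
    - apply: compact_chain_closed; first by have [] := Qcs n.
      + by exists s0.
      + by move=> s t /Atot H /H[/asboolP|/asboolP] st; [right|left]; exact: st.
      + by move=> s _; have [[]] := svalP s.
      + by move=> s _; have [[]] := svalP s.
    - by have [[_ _ +] _] := svalP s; apply=> //; exact: Cx.
  have CC0 n : C n `<=` C0 n.
    by move=> x /(_ _ As0); have [_ +] := svalP s0; exact.
  exists (exist _ C (conj fC CC0)) => s As.
  by apply/asboolP => n x /(_ _ As).
- exists C; split=> //; split=> // C' fC' C'C.
  have C'C0 n : C' n `<=` C0 n by apply: subset_trans (CC0 n).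
  have := Cmin (exist _ C' (conj fC' C'C0)).
  by move=> /(_ _)/asboolP; apply; apply/asboolP.
Qed.

(** If [C n] is not inside [A], cutting the family by the cylinder of [A] makes it strictly smaller,
    so by minimality the cut misses [Q] at some stage. The same goes for [B]. At a common later
    stage, a point of [C] and [Q] would map into [C n] but outside both [A] and [B]. *)
Lemma minimal_family_irreducible C n :
  minimal_family C -> irreducible_closed (C n).
Proof.
move=> [[Cc CQ Cmap] Cmin]; split=> //; first by have [x []] := CQ n; exists x.
move=> A B cA cB CAB; apply: contrapT => /not_orP[nA nB].
pose cut (E : set (X n)) j := C j `&` cylinder E.
have cut_empty E : closed E -> ~ C n `<=` E -> exists j, forall x,
    C j x -> Q j x -> ~ forall nj : (n <= j)%O, E (ps_map nj x).
  move=> cE CE; apply: contrapT => ne; apply: CE.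
  suff fcut : family (cut E).
    have H := Cmin _ fcut (fun j x => @proj1 _ _) n.
    by move=> x /H[_ /(_ (lexx _))]; rewrite ps_map_id.
  split=> [j|j|i j ij x [Cx Ex] Qx].
  - by apply: closedI => //; exact: closed_cylinder.
  - apply: contrapT => h; apply: ne; exists j => x Cx Qx Ex.
    by apply: h; exists x.
  - split; first exact: Cmap.
    move=> ni; rewrite (ps_map_comp ni ij (le_trans ni ij)); exact: Ex.
have [a Ha] := cut_empty A cA nA; have [b Hb] := cut_empty B cB nB.
pose l := maxn n (maxn a b).
have nl : (n <= l)%O by rewrite leEnat leq_maxl.
have al : (a <= l)%O by rewrite leEnat /l maxnCA leq_maxl.
have bl : (b <= l)%O by rewrite leEnat /l !maxnA leq_maxr.
have [x [Cx Qx]] := CQ l.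
have [Ax|Bx] := CAB _ (Cmap _ _ nl x Cx Qx).
- apply: (Ha (ps_map al x)); [exact: Cmap|exact: Qmap|] => na.
  by rewrite (ps_map_comp na al nl).
- apply: (Hb (ps_map bl x)); [exact: Cmap|exact: Qmap|] => nb.
  by rewrite (ps_map_comp nb bl nl).
Qed.

Hypothesis Xsober : forall n, sober_space (X n).

(* The generic points of the members of a minimal family form a thread. *)
Lemma minimal_family_thread C : minimal_family C ->
  exists x : forall n, X n, (forall n, C n (x n) /\ Q n (x n)) /\
    forall m n (mn : (m <= n)%O), ps_map mn (x n) = x m.
Proof.
move=> mC; have [[Cc CQ Cmap] Cmin] := mC.
have gen n : {x : X n | C n = closure [set x]}.
  by apply: cid; apply: (Xsober n).2; exact: minimal_family_irreducible.
pose x n := sval (gen n); have Cx n : C n = closure [set x n] := svalP (gen n).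
have xC n : C n (x n) by rewrite Cx; exact: subset_closure.
(* The generic point lies above every point of [C n] in the specialization order, and the saturated
   set [Q n] contains one of these. *)
have xQ n : Q n (x n).
  have [y [Cy Qy]] := CQ n.
  apply: saturated_specialization Qy; first by have [] := Qcs n.
  by rewrite -Cx.
exists x; split=> // m n mn.
apply: kolmogorov_eq; [exact: (Xsober m).1| |]; last first.
  by rewrite -Cx; exact: Cmap.
(* Confining [C] to the closure of the image of [x n] at the stages below [n] leaves a family. By
   minimality it still contains [x m], which is the missing half of the T0 argument. *)
pose C' j := C j `&`
  [set y | forall jn : (j <= n)%O, closure [set ps_map jn (x n)] y].
suff fC' : family C'.
  by have [_] := Cmin _ fC' (fun j y => @proj1 _ _) m (x m) (xC m); exact.
split=> [j|j|j l jl y [Cy xy] Qy].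
- apply: closedI => //; have [jn|jn] := pselect (j <= n)%O; last first.
    rewrite (_ : [set x | _] = setT) //.
    by apply/seteqP; split=> // z _ jn'.
  rewrite (_ : [set x | _] = closure [set ps_map jn (x n)]).
    exact: closed_closure.
  apply/seteqP; split=> z; first exact.
  by move=> /= Ex jn'; rewrite (bool_irrelevance jn' jn).
- have [jn|jn] := pselect (j <= n)%O; last first.
    by have [y [Cy Qy]] := CQ j; exists y; split=> //; split.
  exists (ps_map jn (x n)); split; last exact: Qmap.
  split=> [|jn']; first exact: Cmap.
  by rewrite (bool_irrelevance jn' jn); exact: subset_closure.
- split; first exact: Cmap.
  move=> jn; have [ln|nl] := leP l n.
    rewrite -(ps_map_comp jl ln jn); apply: closure_set1_image; last exact: xy.
    exact: ps_continuous.
  rewrite -(ps_map_comp jn (ltW nl) jl); apply: closure_set1_image.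
    exact: ps_continuous.
  by rewrite -Cx; exact: Cmap.
Qed.

(** If no [U n] contains [Q n], the complements form a family; the thread of a minimal family below
    it avoids every [U n]. *)
Lemma steenrod (U : forall n, set (X n)) :
  (forall n, open (U n)) ->
  (forall m n (mn : (m <= n)%O) x, U m (ps_map mn x) -> U n x) ->
  (forall x : forall n, X n, (forall n, Q n (x n)) ->
    (forall m n (mn : (m <= n)%O), ps_map mn (x n) = x m) ->
    exists n, U n (x n)) ->
  exists n, Q n `<=` U n.
Proof.
move=> Uo Umap cover; apply: contrapT => nU.
have fam : family (fun n => ~` U n).
  split=> [n|n|m n mn x nUx _ Ux]; first exact: open_closedC.
    apply: contrapT => h; apply: nU; exists n => x Qx; apply: contrapT => nx.
    by apply: h; exists x.
  exact: nUx (Umap _ _ mn _ Ux).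
have [C [mC CU]] := exists_minimal_family fam.
have [x [xCQ xmap]] := minimal_family_thread mC.
have [|n Ux] := cover x _ xmap; first by move=> n; have [] := xCQ n.
by apply: (CU n (x n)) => //; have [] := xCQ n.
Qed.

End Steenrod.

(** * G-delta subspaces of locally compact sober spaces *)

Section Embeddings.
Variables (S T : topologicalType) (f : S -> T).
Hypothesis femb : topological_embedding f.

Lemma embedding_open (V : set T) : open V -> open (f @^-1` V).
Proof. by move=> oV; apply/femb.2; exists V. Qed.

Lemma embedding_continuous : continuous f.
Proof. by apply/continuousP => V; exact: embedding_open. Qed.

(** The image of an irreducible closed set has an irreducible closure, hence a generic point in [T].
    Each open [G k] meets that closure, so it contains the generic point, which therefore lies in
    the range of [f]. *)
Lemma sober_Gdelta : Gdelta (range f) -> sober_space T -> sober_space S.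
Proof.
move=> [G Gop rG] [T0 Tsob]; split=> [x y xy|C [cC [c Cc] Cirr]].
  have fxy : f x != f y by apply: contra_neq xy; exact: femb.1.
  have pre z A : nbhs (f z) A -> nbhs z (f @^-1` A).
    rewrite !nbhsE => -[V [oV Vz] VA]; exists (f @^-1` V) => [|u]; last exact: VA.
    by split=> //; exact: embedding_open.
  have [A [|]] := T0 _ _ fxy; rewrite !inE => -[nA mA]; exists (f @^-1` A).
    by left; rewrite !inE; split; [exact: pre|].
  by right; rewrite !inE; split; [exact: pre|].
have [y Cy] : exists y, closure (f @` C) = closure [set y].
  apply: Tsob; split; first exact: closed_closure.
    by exists (f c); apply: subset_closure; exists c.
  have sub A : closed A -> C `<=` f @^-1` A -> closure (f @` C) `<=` A.
    by move=> cA CA; apply: closure_sub_closed => // _ [x Cx <-]; exact: CA.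
  move=> A B cA cB CAB; have clo D : closed D -> closed (f @^-1` D).
    move=> cD; rewrite -openC preimage_setC; apply: embedding_open.
    exact: closed_openC.
  have [] := Cirr _ _ (clo A cA) (clo B cB).
  - by move=> x Cx; apply: CAB; apply: subset_closure; exists x.
  - by left; exact: sub.
  - by right; exact: sub.
have [x _ fx] : range f y.
  rewrite rG => k _; have : closure (f @` C) (f c).
    by apply: subset_closure; exists c.
  rewrite Cy => /closure_set1P; apply; first exact: Gop.
  by have : range f (f c) by []; rewrite rG; exact.
exists x; apply/seteqP; split=> [z Cz|].
  apply/closure_set1P => U /femb.2[V oV ->] Vz.
  have : closure (f @` C) (f z) by apply: subset_closure; exists z.
  by rewrite Cy -fx => /closure_set1P; apply.
apply: closure_sub_closed => // _ ->; apply: contrapT => nCx.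
have /femb.2[V oV VC] := closed_openC cC.
have : closure (f @` C) (f x) by rewrite Cy fx; exact: subset_closure.
have Vx : (f @^-1` V) x by rewrite -VC.
move=> /(_ _ (open_nbhs_nbhs (conj oV Vx)))[_ [[z Cz <-] Vz]].
by have : (f @^-1` V) z by []; rewrite -VC.
Qed.

End Embeddings.

(** Along a sequence of successively interpolated sets, the intersection is also that of a
    decreasing sequence of compact saturated sets. *)
Definition interpolated (T : topologicalType) (B A : set T) : Prop :=
  exists Q, [/\ compact_saturated Q, B `<=` Q & Q `<=` A].

Lemma interpolated_trans (T : topologicalType) (B' B A A' : set T) :
  B' `<=` B -> A `<=` A' -> interpolated B A -> interpolated B' A'.
Proof.
move=> B'B AA' [Q [cQ BQ QA]].
by exists Q; split=> //; [exact: subset_trans BQ|exact: subset_trans AA'].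
Qed.

Lemma constant_system_directed :
  directed (fun m n : nat => (m <= n)%O : Prop) [set: nat].
Proof.
split; first by exists 0.
by move=> m n _ _; exists (maxn m n) => //; rewrite !leEnat leq_maxl leq_maxr.
Qed.

Definition constant_system (T : topologicalType) : projective_system nat :=
  {| ps_space := fun=> T;
     ps_map := fun _ _ _ => id;
     ps_directed := constant_system_directed;
     ps_continuous := fun _ _ _ _ => @cvg_id T _;
     ps_map_id := fun _ _ _ => erefl;
     ps_map_comp := fun _ _ _ _ _ _ _ => erefl |}.

(* Steenrod's theorem for a constant system is the well-filteredness of sober
   spaces. *)
Lemma interpolated_well_filtered (T : topologicalType) (A : nat -> set T)
    (V : set T) :
  sober_space T -> (forall k, interpolated (A k.+1) (A k)) ->
  open V -> \bigcap_k A k `<=` V -> exists k, A k `<=` V.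
Proof.
move=> Tsob Aint oV AV; pose Q k := sval (cid (Aint k)).
have [Qcs AQ QA] : [/\ forall k, compact_saturated (Q k),
    forall k, A k.+1 `<=` Q k & forall k, Q k `<=` A k].
  by split=> k; rewrite /Q; case: cid => ? [].
have Qdecr m n : (m <= n)%N -> Q n `<=` Q m.
  elim: n => [|n IH]; first by rewrite leqn0 => /eqP ->.
  rewrite leq_eqVlt => /predU1P[->//|/IH]; apply: subset_trans.
  exact: subset_trans (AQ n).
have [|||||n QV] := @steenrod (constant_system T) Q Qcs _ _ (fun=> V).
- by move=> m n mn x; exact: Qdecr.
- by [].
- by [].
- by [].
- move=> x Qx xc; exists 0; apply: AV => k _; apply: QA.
  by rewrite (_ : x 0 = x k) //; exact/esym/(xc 0 k).
- by exists n.+1; exact: subset_trans QV.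
Qed.

(** The open sets of [T] whose trace lies in a member of [D] are directed and cover the intersection
    of the [A k]. Well-filteredness puts some [A k] inside their union, and the compact set between
    [A k.+1] and [A k] reduces the union to one member. This yields both compactness of the trace
    and a neighbourhood basis of it. *)
Lemma interpolated_preimage_cover (S T : topologicalType) (f : S -> T)
    (A : nat -> set T) (D : set (set S)) :
  topological_embedding f -> sober_space T ->
  (forall k, interpolated (A k.+1) (A k)) -> \bigcap_k A k `<=` range f ->
  D `<=` open -> directed (@subset S) D ->
  f @^-1` (\bigcap_k A k) `<=` \bigcup_(U in D) U ->
  exists2 U, D U & exists k, f @^-1` A k `<=` U.
Proof.
move=> femb Tsob Aint Af Dop [[U0 DU0] Ddir] AD.
pose E : set (set T) := [set V | open V /\ exists2 U, D U & f @^-1` V `<=` U].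
have Eop : E `<=` open by move=> V [].
have [||k Ak] := @interpolated_well_filtered _ A (\bigcup_(V in E) V) Tsob Aint.
- by apply: bigcup_open => V /Eop.
- move=> y Ay; have [x _ fx] := Af _ Ay; subst y.
  have [U DU Ux] := AD _ Ay; have /femb.2[V oV UV] := Dop _ DU.
  exists V; last by rewrite UV in Ux.
  by split=> //; exists U => //; rewrite UV.
have [Q [[/compact_directedP cQ _] AQ QA]] := Aint k.
have [|V [_ [U DU VU]] QV] := cQ E Eop _ (subset_trans QA Ak).
- split; first by exists set0; split; [exact: open0|exists U0].
  move=> V V' [oV [U DU VU]] [oV' [U' DU' VU']].
  have [U'' DU'' [UU U'U]] := Ddir _ _ DU DU'.
  exists (V `|` V'); last by split=> x; [left|right].
  split; first exact: openU.
  by exists U'' => // x [/VU/UU|/VU'/U'U].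
exists U => //; exists k.+1; apply: subset_trans VU.
by apply: preimage_subset; exact: subset_trans QV.
Qed.

Lemma interpolated_preimage_compact_saturated (S T : topologicalType)
    (f : S -> T) (A : nat -> set T) :
  topological_embedding f -> sober_space T -> (forall k, open (A k)) ->
  (forall k, interpolated (A k.+1) (A k)) -> \bigcap_k A k `<=` range f ->
  compact_saturated (f @^-1` (\bigcap_k A k)).
Proof.
move=> femb Tsob Aop Aint Af; split.
  apply/compact_directedP => D Dop Ddir AD.
  have [U DU [k AU]] :=
    interpolated_preimage_cover femb Tsob Aint Af Dop Ddir AD.
  by exists U => // x Ax; apply: AU; exact: Ax.
exists (range (fun k => f @^-1` A k)).
  by move=> _ [k _ <-]; exact: embedding_open.
apply/seteqP; split=> [x Ax _ [k _ <-]|x Ax k _]; first exact: Ax.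
by apply: (Ax (f @^-1` A k)); exists k.
Qed.

Lemma interpolated_preimage_open (S T : topologicalType) (f : S -> T)
    (A : nat -> set T) (U : set S) :
  topological_embedding f -> sober_space T ->
  (forall k, interpolated (A k.+1) (A k)) -> \bigcap_k A k `<=` range f ->
  open U -> f @^-1` (\bigcap_k A k) `<=` U ->
  exists k, f @^-1` A k `<=` U.
Proof.
move=> femb Tsob Aint Af oU AU.
have [|||_ -> //] :=
  interpolated_preimage_cover (D := [set U]) femb Tsob Aint Af.
- by move=> _ ->.
- split; first by exists U.
  by move=> _ _ -> ->; exists U => //; split.
- by rewrite bigcup_set1.
Qed.

(** * Tightness along a projective sequence *)

Section Valuations.
Context {R : realType} {T : topologicalType} {nu : set T -> \bar R}.
Hypothesis hnu : continuous_valuation nu.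

Lemma valuation_le U V : open U -> open V -> U `<=` V -> (nu U <= nu V)%E.
Proof. by have [[_ _ + _] _] := hnu; exact. Qed.

Lemma lt_valuation_bigcup (D : set (set T)) r : D `<=` open ->
  directed (@subset T) D -> (r < nu (\bigcup_(U in D) U))%E ->
  exists2 U, D U & (r < nu U)%E.
Proof.
move=> Dop Ddir; rewrite hnu.2// => /ereal_sup_gt[_ [U DU <-] rU].
by exists U.
Qed.

End Valuations.

(** Finite intersections make the sequence decreasing, so that arbitrarily late [W k] still cut out
    the range; the diagonal construction meets each coordinate only from some step on. *)
Lemma embeds_as_GdeltaP (S : topologicalType) : embeds_as_Gdelta S ->
  exists (T : topologicalType) (f : S -> T) (W : nat -> set T),
    [/\ locally_compact_space T, sober_space T, topological_embedding f,
        forall k, open (W k) /\ forall j, (j <= k)%N -> W k `<=` W j &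
        range f = \bigcap_k W k].
Proof.
move=> [T [f [Tlc Tsob femb [G Gop rG]]]]; exists T, f.
exists (fun k => \bigcap_(i in `I_k.+1) G i); split=> //.
  move=> k; split=> [|j jk x Gx i ij]; last first.
    by apply: Gx; apply: leq_trans jk.
  rewrite bigcap_mkord; apply: big_ind => //; [exact: openT|exact: openI].
rewrite rG; apply/seteqP; split=> x Gx k _; first by move=> i _; exact: Gx.
by apply: (Gx k) => /=.
Qed.

Section FatThreads.
Context {R : realType}.
Variables (X : projective_system nat) (nu : forall n, set (X n) -> \bar R).
Variables (Y : nat -> topologicalType) (f : forall n, X n -> Y n).
Variable W : forall n, nat -> set (Y n).
Arguments nu : clear implicits.
Arguments f : clear implicits.
Arguments W : clear implicits.
Hypothesis hnu : valued_system nu.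
Hypothesis Ylc : forall n, locally_compact_space (Y n).
Hypothesis Ysob : forall n, sober_space (Y n).
Hypothesis femb : forall n, topological_embedding (f n).
Hypothesis Wop : forall n k, open (W n k).
Hypothesis Wdecr : forall n k j, (j <= k)%N -> W n k `<=` W n j.
Hypothesis rf : forall n, range (f n) = \bigcap_k W n k.
Variable r : \bar R.

(* A n is an open subset of the ambient space Y n. The traces on the X n form
   a subsystem of X, which from stage N on consists of the full preimages of
   the trace at stage N. *)
Let state N (A : forall n, set (Y n)) : Prop :=
  [/\ forall n, open (A n),
      forall m n (mn : (m <= n)%O) x, A n (f n x) -> A m (f m (ps_map mn x)),
      forall n (Nn : (N <= n)%O) x, A N (f N (ps_map Nn x)) -> A n (f n x) &
      (r < nu N (f N @^-1` A N))%E].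

(** At stages not above [N] the cylinder of [V] is the whole space, so no constraint is imposed
    there yet. *)
Lemma state_initial N V : open V -> (r < nu N V)%E ->
  exists A, state N A /\ f N @^-1` A N = V.
Proof.
move=> oV rV.
have ext n : {B : set (Y n) | open B /\ f n @^-1` B = cylinder V}.
  apply: cid; have /(femb n).2[B oB BV] := @open_cylinder _ _ X N n V oV.
  by exists B.
pose A n := sval (ext n); have Aop n : open (A n) by have [] := svalP (ext n).
have Acyl n x : A n (f n x) = cylinder V x.
  by have [_ <-] := svalP (ext n).
have AN : f N @^-1` A N = V.
  have [_ ->] := svalP (ext N); rewrite (cylinderE (lexx N)).
  by apply/seteqP; split=> x /=; rewrite ps_map_id.
exists A; split=> //; split=> // [m n mn x|n Nn x|]; last by rewrite AN.
- rewrite !Acyl => Vx Nm; rewrite (ps_map_comp Nm mn (le_trans Nm mn)).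
  exact: Vx.
- by rewrite !Acyl => + Nn' => /(_ (lexx N)); rewrite (ps_map_comp _ _ Nn').
Qed.

Lemma state_lt N A m : (m <= N)%O -> state N A ->
  (r < nu m (f m @^-1` A m))%E.
Proof.
move=> mN [Aop Amap _ rA]; apply: lt_le_trans rA _.
rewrite -(hnu.2 _ _ mN); last exact: embedding_open.
apply: (valuation_le (hnu.1 N)); [exact: embedding_open| |] => [|x]; last first.
  exact: Amap.
apply: open_comp; last exact: embedding_open.
by move=> x _; exact: ps_continuous.
Qed.

Lemma state_raise N N' A : (N <= N')%O -> state N A -> state N' A.
Proof.
move=> NN' [Aop Amap Atail rA]; split=> // [n N'n x Ax|].
  apply: (Atail _ (le_trans NN' N'n)).
  by rewrite -(ps_map_comp NN' N'n); exact: Amap.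
rewrite -(hnu.2 _ _ NN') in rA; last exact: embedding_open.
rewrite (_ : f N' @^-1` A N' = ps_map NN' @^-1` (f N @^-1` A N)) //.
by apply/seteqP; split=> x; [exact: Amap|exact: Atail].
Qed.

(** By local compactness, the intersection of [A m] and [W m k] is a directed union of interiors of
    compact saturated sets. Pulled back to stage [N], these cover the trace of [A N], and continuity
    of [nu N] selects one that keeps the valuation above [r]. All stages above [m] are then cut by
    its cylinder. *)
Lemma state_refine N A m k : (m <= N)%O -> state N A ->
  exists A', [/\ state N A', forall n, A' n `<=` A n &
    interpolated (A' m) (A m `&` W m k)].
Proof.
move=> mN [Aop Amap Atail rA].
have pcont : continuous (f m \o ps_map mN).
  move=> x; apply: continuous_comp; first exact: ps_continuous.
  exact: embedding_continuous.
have /continuousP popen := pcont.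
have [[[V0 FV0] Fdir] AF] := Ylc (openI (Aop m) (Wop m k)).
set F := [set Q° | Q in _] in V0 FV0 Fdir AF.
have Fop : F `<=` open by move=> _ [Q _ <-]; exact: open_interior.
pose g B := (f N @^-1` A N) `&` ((f m \o ps_map mN) @^-1` B).
have [|||_ [V FV <-] rV] := @lt_valuation_bigcup _ _ _ (hnu.1 N) (g @` F) r.
- move=> _ [B FB <-]; apply: openI; first exact: embedding_open.
  by apply: popen; exact: Fop.
- split; first by exists (g V0), V0.
  move=> _ _ [B FB <-] [B' FB' <-]; have [C FC [BC B'C]] := Fdir _ _ FB FB'.
  by exists (g C); [exists C|split; apply: setIS; exact: preimage_subset].
- apply: lt_le_trans rA _; apply: (valuation_le (hnu.1 N)).
  + exact: embedding_open.
  + apply: bigcup_open => _ [B FB <-]; apply: openI; first exact: embedding_open.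
    by apply: popen; exact: Fop.
  + move=> x Ax; have : (A m `&` W m k) (f m (ps_map mN x)).
      split; first exact: Amap.
      by have : range (f m) (f m (ps_map mN x)) by []; rewrite rf; exact.
    by rewrite AF => -[B FB Bx]; exists (g B) => //; exists B.
have [Q [cQ QA] QV] := FV.
(* Coordinate [m] receives [V] itself, which lies in the compact set [Q]; at the other coordinates
   only the trace matters. *)
have ref n : {B : set (Y n) | [/\ open B, B `<=` A n,
    f n @^-1` B = (f n @^-1` A n) `&` cylinder (f m @^-1` V) &
    n = m -> interpolated B (A n `&` W n k)]}.
  apply: cid; have [nm|nm] := pselect (n = m).
    subst n; exists V; split; first exact: Fop.
    - by move=> y; rewrite -QV => /interior_subset /QA[].
    - rewrite (cylinderE (lexx m)); apply/seteqP; split=> x /=.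
        rewrite ps_map_id; split=> //.
        by move: H; rewrite -QV => /interior_subset /QA[].
      by rewrite ps_map_id => -[].
    - by move=> _; exists Q; split=> //; rewrite -QV; exact: interior_subset.
  have oV : open (f m @^-1` V) by apply: embedding_open => //; exact: Fop.
  have /(femb n).2[B oB BV] := @open_cylinder _ _ X m n _ oV.
  exists (A n `&` B); split=> //; first exact: openI.
    by rewrite preimage_setI -BV.
pose A' n := sval (ref n).
have A'E n x : A' n (f n x) <-> A n (f n x) /\ cylinder (f m @^-1` V) x.
  have [_ _ BE _] := svalP (ref n).
  by rewrite -[A' n (f n x)]/((f n @^-1` sval (ref n)) x) BE.
exists A'; split=> [|n|]; last 2 first.
- by have [] := svalP (ref n).
- by have [_ _ _] := svalP (ref m); exact.
split=> [n|j n jn x /A'E[Ax Vx]|n Nn x /A'E[Ax Vx]|].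
- by have [] := svalP (ref n).
- apply/A'E; split; first exact: Amap.
  by move=> mj; rewrite /= (ps_map_comp mj jn (le_trans mj jn)); exact: Vx.
- apply/A'E; split; first exact: Atail.
  by move=> mn; have := Vx mN; rewrite /= (ps_map_comp mN Nn mn).
- rewrite (_ : _ @^-1` _ = g V) //; apply/seteqP; split=> x.
    by move=> /A'E[Ax /(_ mN)].
  move=> [Ax Vx]; apply/A'E; split=> // mN'.
  by rewrite (bool_irrelevance mN' mN).
Qed.

(** The coordinates are treated one after another; later shrinking preserves the interpolations
    already obtained. *)
Lemma state_refine_upto N A k M : (M <= N.+1)%N -> state N A ->
  exists A', [/\ state N A', forall n, A' n `<=` A n &
    forall m, (m < M)%N -> interpolated (A' m) (A m `&` W m k)].
Proof.
move=> + sA; elim: M => [_|M IH MN]; first by exists A; split=> // n x.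
have [A' [sA' A'A A'int]] := IH (ltnW MN).
have [A'' [sA'' A''A' A''int]] := @state_refine N A' M k MN sA'.
exists A''; split=> // [n|m]; first exact: subset_trans (A'A n).
rewrite ltnS leq_eqVlt => /predU1P[->|/A'int].
  by apply: interpolated_trans A''int => //; apply: setSI; exact: A'A.
by apply: interpolated_trans => //; exact: A''A'.
Qed.

(** Step [k] refines all coordinates up to [N + k] and then raises the base stage by one, so every
    coordinate is eventually refined at each step. *)
Lemma state_sequence N A0 : state N A0 ->
  exists A : nat -> forall n, set (Y n),
    [/\ forall k, state (N + k)%N (A k), A 0 = A0,
        forall k n, A k.+1 n `<=` A k n &
        forall k m, (m <= N + k)%N ->
          interpolated (A k.+1 m) (A k m `&` W m k)].
Proof.
move=> sA0.
have step k A : state (N + k)%N A -> {A' | [/\ state (N + k.+1)%N A',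
    forall n, A' n `<=` A n & forall m, (m <= N + k)%N ->
      interpolated (A' m) (A m `&` W m k)]}.
  move=> sA; apply: cid.
  have [A' [sA' A'A A'int]] := @state_refine_upto _ A k _ (leqnn _) sA.
  exists A'; split=> //.
  by apply: state_raise sA'; rewrite leEnat addnS.
have s0 : state (N + 0)%N A0 by rewrite addn0.
pose s := fix s k : {A | state (N + k)%N A} :=
  if k is k'.+1 then
    let A' := step k' (sval (s k')) (svalP (s k')) in
    exist _ (sval A') (let: And3 sA' _ _ := svalP A' in sA')
  else exist _ A0 s0.
exists (fun k => sval (s k)); split=> // [k|k|k].
- exact: svalP (s k).
- by rewrite /=; case: (step _ _ _) => A' [].
- by rewrite /=; case: (step _ _ _) => A' [].
Qed.

Lemma compact_thread_of_embeddings N V : open V -> (r < nu N V)%E ->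
  exists Q : forall n, set (X n),
    [/\ forall n, compact_saturated (Q n),
        forall m n (mn : (m <= n)%O) x, Q n x -> Q m (ps_map mn x),
        Q N `<=` V &
        forall n U, open U -> Q n `<=` U -> (r < nu n U)%E].
Proof.
move=> oV rV; have [A0 [sA0 A0V]] := state_initial oV rV.
have [A [sA A00 Adecr Aint]] := state_sequence sA0.
(* Dropping the first [m] steps ensures that coordinate [m] is refined at every remaining step; as
   the [A k] decrease, the intersection is unchanged. *)
pose B m k := A (m + k)%N m.
have Bop m k : open (B m k) by have [] := sA (m + k)%N.
have Bint m k : interpolated (B m k.+1) (B m k `&` W m (m + k)%N).
  by rewrite /B addnS; apply: Aint; rewrite addnCA leq_addr.
have Bint' m k : interpolated (B m k.+1) (B m k).
  by apply: interpolated_trans (Bint m k) => // x [].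
have Adecr' k j n : (j <= k)%N -> A k n `<=` A j n.
  elim: k => [|k IH]; first by rewrite leqn0 => /eqP ->.
  rewrite leq_eqVlt => /predU1P[->//|/IH]; apply: subset_trans.
  exact: Adecr.
have BA m : \bigcap_k B m k = \bigcap_k A k m.
  apply/seteqP; split=> y By k _; last exact: By.
  by apply: (@Adecr' (m + k)%N); [exact: leq_addl|exact: By].
have Bf m : \bigcap_k B m k `<=` range (f m).
  move=> y By; rewrite rf => k _; have [Q [_ BQ QW]] := Bint m k.
  apply: (@Wdecr m (m + k)%N); first exact: leq_addl.
  by have [] := QW _ (BQ _ (By k.+1 I)).
exists (fun n => f n @^-1` (\bigcap_k B n k)); split.
- by move=> n; exact: interpolated_preimage_compact_saturated.
- move=> m n mn x /=; rewrite !BA => Ax k _; have [_ + _ _] := sA k.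
  by apply; exact: Ax.
- by move=> x /=; rewrite BA => /(_ 0 I); rewrite A00 -A0V.
(* Already some [B n k] has its trace inside [U], and its valuation exceeds [r] because [n] is at
   most the base stage [N + (n + k)]. *)
- move=> n U oU BU.
  have [k BkU] := interpolated_preimage_open (femb n) (Ysob n) (Bint' n) (Bf n)
    oU BU.
  apply: lt_le_trans (valuation_le (hnu.1 n) _ oU BkU); last first.
    exact: embedding_open.
  apply: state_lt (sA (n + k)%N); rewrite leEnat addnCA; exact: leq_addr.
Qed.

End FatThreads.

Lemma compact_thread (R : realType) (X : projective_system nat)
    (nu : forall n, set (X n) -> \bar R) (r : \bar R) N (V : set (X N)) :
  valued_system nu -> (forall n, embeds_as_Gdelta (X n)) ->
  open V -> (r < nu N V)%E ->
  exists Q : forall n, set (X n),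
    [/\ forall n, compact_saturated (Q n),
        forall m n (mn : (m <= n)%O) x, Q n x -> Q m (ps_map mn x),
        Q N `<=` V &
        forall n U, open U -> Q n `<=` U -> (r < nu n U)%E].
Proof.
move=> hnu hemb oV rV.
pose Y n := cid (embeds_as_GdeltaP (hemb n)).
pose f n := cid (svalP (Y n)); pose W n := cid (svalP (f n)).
have H n := svalP (W n).
apply: (@compact_thread_of_embeddings R X nu (fun n => sval (Y n))
  (fun n => sval (f n)) (fun n => sval (W n))) => // n.
- by have [] := H n.
- by have [] := H n.
- by have [] := H n.
- by move=> k; have [_ _ _ /(_ k)[]] := H n.
- by move=> k j; have [_ _ _ /(_ k)[_ +] _] := H n; exact.
- by have [] := H n.
Qed.

(** * Projective limits *)

Section TopologyOfOpens.
Variables (L : choiceType) (op : set (set L)).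

(** An alias of [L] that takes the closure properties of [op] as arguments, so that a second
    topology can be attached to the same points. *)
Definition topology_of_opens (opT : op setT) (opI : setI_closed op)
  (opU : forall (J : Type) (F : J -> set L), (forall j, op (F j)) ->
    op (\bigcup_j F j)) : Type := L.

Hypotheses (opT : op setT) (opI : setI_closed op).
Hypothesis opU : forall (J : Type) (F : J -> set L), (forall j, op (F j)) ->
  op (\bigcup_j F j).

HB.instance Definition _ := Choice.on (topology_of_opens opT opI opU).
HB.instance Definition _ :=
  isOpenTopological.Build (topology_of_opens opT opI opU) opT opI opU.

End TopologyOfOpens.

Section ProjectiveLimits.
Context {d : Order.disp_t} {I : preorderType d} (X : projective_system I).
Variables (L : topologicalType) (p : forall i, L -> X i).
Arguments p : clear implicits.
Hypothesis hL : projective_limit p.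

Lemma limit_map i j (ij : (i <= j)%O) x : ps_map ij (p j x) = p i x.
Proof. exact: hL.1.2. Qed.

Lemma limit_preimage i j (ij : (i <= j)%O) (V : set (X i)) :
  p j @^-1` (ps_map ij @^-1` V) = p i @^-1` V.
Proof. by apply/seteqP; split=> x /=; rewrite limit_map. Qed.

Lemma limit_open i V : open V -> open (p i @^-1` V).
Proof. by move=> oV; apply: open_comp => // x _; exact: hL.1.1. Qed.

Let cone_open (U : set L) : Prop :=
  forall x, U x -> exists i (V : set (X i)),
    [/\ open V, V (p i x) & p i @^-1` V `<=` U].

(* The universal property is applied to L itself with the topology generated by
   the preimages under the p i: the map obtained is a continuous identity. *)
Lemma limit_base U x : open U -> U x ->
  exists i (V : set (X i)), [/\ open V, V (p i x) & p i @^-1` V `<=` U].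
Proof.
have coT : cone_open setT.
  move=> y _; have [[i _] _] := ps_directed X.
  by exists i, setT; split=> //; exact: openT.
have coI : setI_closed cone_open.
  move=> V W oV oW y [Vy Wy].
  have [i [A [oA Ay AV]]] := oV _ Vy; have [j [B [oB By BW]]] := oW _ Wy.
  have [_ /(_ i j Logic.I Logic.I)[k _ [ik jk]]] := ps_directed X.
  exists k, ((ps_map ik @^-1` A) `&` (ps_map jk @^-1` B)).
  split=> [||z []] /=.
  - by apply: openI; apply: open_comp => // ? _; exact: ps_continuous.
  - by rewrite !limit_map.
  - by rewrite !limit_map => Az Bz; split; [exact: AV|exact: BW].
have coU (J : Type) (F : J -> set L) : (forall j, cone_open (F j)) ->
    cone_open (\bigcup_j F j).
  move=> oF y [j _ Fy]; have [i [A [oA Ay AF]]] := oF _ _ Fy.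
  by exists i, A; split=> // z /AF; exists j.
pose Z : topologicalType := topology_of_opens coT coI coU.
have Zcone : projective_cone (p : forall i, Z -> X i).
  split=> [i|i j ij z]; last exact: limit_map.
  apply/continuousP => V oV; have : cone_open (p i @^-1` V).
    by move=> y Vy; exists i, V; split.
  exact.
have [h [[/continuousP hc hp] _]] := hL.2 Z _ Zcone.
(* Uniqueness for the cone [L] over itself: the identity and [h] are both mediating maps. *)
have [g [_ guniq]] := hL.2 L p hL.1.
have gid : g = id by apply: guniq; split=> // y; exact: cvg_id.
have hid : h = id.
  rewrite -gid; apply/esym/guniq; split=> //; apply/continuousP => V oV.
  have coV : cone_open (h @^-1` V) := hc _ oV.
  rewrite openE => y Vy; have [i [A [oA Ay AV]]] := coV _ Vy.
  rewrite /interior /= nbhsE; exists (p i @^-1` A) => //.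
  by split=> //; exact: limit_open.
by move=> oU; have : cone_open (h @^-1` U) := hc _ oU; rewrite hid; exact.
Qed.

Lemma limit_thread (x : forall i, X i) :
  (forall i j (ij : (i <= j)%O), ps_map ij (x j) = x i) ->
  exists l, forall i, p i l = x i.
Proof.
(* A thread is a cone of constant maps on any nonempty test space; [bool] serves as one. *)
move=> xc; have [|h [[_ hp] _]] := hL.2 bool (fun i _ => x i).
  by split=> // i; exact: cst_continuous.
by exists (h true) => i; exact: hp.
Qed.

(** On open sets this is right adjoint to preimage under [p i], so it commutes with binary
    intersections. *)
Definition shadow i (U : set L) : set (X i) :=
  \bigcup_(V in [set V | open V /\ p i @^-1` V `<=` U]) V.

Arguments shadow : clear implicits.

Lemma open_shadow i U : open (shadow i U).
Proof. by apply: bigcup_open => V []. Qed.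

Lemma shadow_sub i U : p i @^-1` shadow i U `<=` U.
Proof. by move=> x [V [_ VU] /VU]. Qed.

Lemma sub_shadow i U V : open V -> p i @^-1` V `<=` U -> V `<=` shadow i U.
Proof. by move=> oV VU x Vx; exists V. Qed.

Lemma shadowS i U U' : U `<=` U' -> shadow i U `<=` shadow i U'.
Proof.
move=> UU'; apply: sub_shadow; first exact: open_shadow.
by apply: subset_trans UU'; exact: shadow_sub.
Qed.

Lemma shadowI i U U' : shadow i (U `&` U') = shadow i U `&` shadow i U'.
Proof.
apply/seteqP; split.
  by move=> x Ux; split; apply: shadowS Ux => y [].
apply: sub_shadow; first by apply: openI; exact: open_shadow.
by move=> x [Ux U'x]; split; exact: (@shadow_sub i).
Qed.

Lemma shadow_map i j (ij : (i <= j)%O) U :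
  ps_map ij @^-1` shadow i U `<=` shadow j U.
Proof.
apply: sub_shadow; last by rewrite limit_preimage; exact: shadow_sub.
apply: open_comp; last exact: open_shadow.
by move=> x _; exact: ps_continuous.
Qed.

End ProjectiveLimits.

Arguments shadow {d I X L} p i U _.
Arguments shadow_map {d I X L p} hL {i j} ij {U} [t] _.

(** * Reduction to a cofinal sequence *)

Lemma cofinal_sequence (d : Order.disp_t) (I : preorderType d) :
  directed (fun i j : I => (i <= j)%O : Prop) [set: I] ->
  has_countable_cofinal I ->
  exists s : nat -> I, (forall m n, (m <= n)%O -> (s m <= s n)%O) /\
    forall i : I, exists n, (i <= s n)%O.
Proof.
move=> [[i0 _] dir] [J /countable_injP[c cinj] Jcof].
have [u uP] : {u : I -> I -> I |
    forall i j : I, (i <= u i j)%O /\ (j <= u i j)%O}.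
  have h (i j : I) : {k : I | (i <= k)%O /\ (j <= k)%O}.
    by apply: cid; have [k _ ?] := dir i j Logic.I Logic.I; exists k.
  by exists (fun i j => sval (h i j)) => i j; exact: svalP (h i j).
(* [e] inverts the injection [c] on [J], with default value [i0] elsewhere. *)
have [e eP] : {e : nat -> I | forall j, J j -> e (c j) = j}.
  exists (fun n => if pselect (exists j, J j /\ c j = n) is left ex
                   then sval (cid ex) else i0) => j Jj.
  case: pselect => [ex|[]]; last by exists j.
  case: cid => j' /= [Jj' cj']; by apply: cinj => //; rewrite inE.
pose s := fix s n := if n is n'.+1 then u (s n') (e n') else i0.
exists s; split=> [m n|i].
  rewrite leEnat; elim: n => [|n IH]; first by rewrite leqn0 => /eqP ->.
  rewrite leq_eqVlt => /predU1P[->//|/IH mn].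
  by apply: le_trans mn _; exact: (uP _ _).1.
(* The term of index [(c j).+1] is chosen above [e (c j)], which is [j]. *)
have [j Jj ij] := Jcof i; exists (c j).+1; apply: le_trans ij _.
by rewrite -[X in (X <= _)%O](eP j Jj); exact: (uP _ _).2.
Qed.

Section Subsystem.
Context {d : Order.disp_t} {I : preorderType d} (X : projective_system I).
Variable s : nat -> I.
Hypothesis smono : forall m n, (m <= n)%O -> (s m <= s n)%O.

Definition subsystem : projective_system nat :=
  {| ps_space := fun n => X (s n);
     ps_map := fun m n mn => ps_map (smono mn);
     ps_directed := constant_system_directed;
     ps_continuous := fun m n mn => @ps_continuous _ _ X _ _ (smono mn);
     ps_map_id := fun n nn x => ps_map_id (smono nn) x;
     ps_map_comp := fun m n k mn nk mk x =>
       ps_map_comp (smono mn) (smono nk) (smono mk) x |}.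

Lemma subsystem_valued (R : realType) (nu : forall i, set (X i) -> \bar R) :
  valued_system nu -> @valued_system _ _ subsystem R (fun n => nu (s n)).
Proof. by move=> [nuc nup]; split=> [n|m n mn]; [exact: nuc|exact: nup]. Qed.

Hypothesis scof : forall i, exists n, (i <= s n)%O.

(** Coordinate [i] is the image of any [x n] with [s n] above [i]; compatibility makes the choice of
    [n] irrelevant. *)
Lemma subsystem_thread (x : forall n, X (s n)) :
  (forall m n (mn : (m <= n)%O), ps_map (smono mn) (x n) = x m) ->
  exists y : forall i, X i,
    (forall i j (ij : (i <= j)%O), ps_map ij (y j) = y i) /\
    forall n, y (s n) = x n.
Proof.
move=> xc.
have proj i m n (im : (i <= s m)%O) (jn : (i <= s n)%O) :
    ps_map im (x m) = ps_map jn (x n).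
  have mk : (m <= maxn m n)%O by rewrite leEnat leq_maxl.
  have nk : (n <= maxn m n)%O by rewrite leEnat leq_maxr.
  rewrite -(xc _ _ mk) -(xc _ _ nk).
  have ik := le_trans im (smono mk).
  by rewrite (ps_map_comp im _ ik) (ps_map_comp jn _ ik).
exists (fun i => ps_map (svalP (cid (scof i))) (x _)); split=> [i j ij|n].
  set h := svalP _; rewrite (ps_map_comp ij h (le_trans ij h)); exact: proj.
by rewrite (proj _ _ n _ (lexx _)) ps_map_id.
Qed.

End Subsystem.

(** * The limit valuation *)

Section LimitValuation.
Context {R : realType} {d : Order.disp_t} {I : preorderType d}.
Variables (X : projective_system I) (nu : forall i, set (X i) -> \bar R).
Variables (L : topologicalType) (p : forall i, L -> X i) (s : nat -> I).
Arguments nu : clear implicits.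
Arguments p : clear implicits.
Hypothesis hnu : valued_system nu.
Hypothesis hL : projective_limit p.
Hypothesis hemb : forall i, embeds_as_Gdelta (X i).
Hypothesis smono : forall m n, (m <= n)%O -> (s m <= s n)%O.
Hypothesis scof : forall i, exists n, (i <= s n)%O.

Definition limit_valuation (U : set L) : \bar R :=
  ereal_sup (range (fun n => nu (s n) (shadow p (s n) U))).

Let increasing (V : forall n, set (X (s n))) : Prop :=
  (forall n, open (V n)) /\
  forall m n (mn : (m <= n)%O), ps_map (smono mn) @^-1` V m `<=` V n.

(** [Q] consists of the points of the limit with all coordinates in a compact thread. Steenrod's
    theorem turns a cover of it by an increasing sequence into a cover of one stage of the
    thread. *)
Lemma limit_compact r N V : open V -> (r < nu (s N) V)%E ->
  exists Q : set L, [/\ compact_saturated Q, Q `<=` p (s N) @^-1` V &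
    forall V', increasing V' -> Q `<=` \bigcup_n (p (s n) @^-1` V' n) ->
      exists n, (r < nu (s n) (V' n))%E].
Proof.
move=> oV rV.
have [Q [Qcs Qmap QV Qr]] := compact_thread
  (subsystem_valued smono hnu) (fun n => hemb (s n)) oV rV.
have Xsob n : sober_space (subsystem X smono n).
  have [T [f [_ Tsob femb fG]]] := hemb (s n).
  exact: sober_Gdelta femb fG Tsob.
pose Q' : set L := [set l | forall n, Q n (p (s n) l)].
have cover V' : increasing V' -> Q' `<=` \bigcup_n (p (s n) @^-1` V' n) ->
    exists n, Q n `<=` V' n.
  move=> [V'o V'map] Q'V'.
  apply: (steenrod Qcs Qmap Xsob V'o) => [m n mn x|x Qx xc]; first exact: V'map.
  have [y [yc yx]] := subsystem_thread scof xc.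
  have [l ly] := limit_thread hL yc.
  have [|n _ V'l] := Q'V' l; first by move=> n; rewrite ly yx.
  by exists n; rewrite -yx -ly.
exists Q'; split=> [|l /(_ N) /QV //|V' V'incr Q'V']; last first.
  have [n QnV'] := cover _ V'incr Q'V'.
  by exists n; apply: Qr QnV'; exact: V'incr.1.
split.
- apply/compact_directedP => D Dop [[U0 DU0] Ddir] Q'D.
  (* The shadows of the members of [D] turn a directed cover into an increasing sequence;
     compactness of one [Q n] then selects a single member. *)
  pose V' n := \bigcup_(U in D) shadow p (s n) U.
  have V'incr : increasing V'.
    split=> [n|m n mn x [U DU Ux]].
      by apply: bigcup_open => U _; exact: open_shadow.
    by exists U => //; exact: (shadow_map hL (smono mn)).
  have [|n QnV'] := cover _ V'incr.
    move=> l /Q'D[U DU Ul].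
    have [i [A [oA Al AU]]] := limit_base hL (Dop _ DU) Ul.
    have [n in_] := scof i; exists n => //; exists U => //.
    apply: (shadow_map hL in_); rewrite /= (limit_map hL).
    exact: (@sub_shadow _ _ _ _ _ _ _ A).
  have /compact_directedP cQ : @compact (X (s n)) (Q n) by have [] := Qcs n.
  have [|||_ [U DU <-] QnU] := cQ (shadow p (s n) @` D).
  + by move=> _ [U _ <-]; exact: open_shadow.
  + split; first by exists (shadow p (s n) U0), U0.
    move=> _ _ [U DU <-] [U' DU' <-]; have [W DW [UW U'W]] := Ddir _ _ DU DU'.
    by exists (shadow p (s n) W); [exists W|split; exact: shadowS].
  + by rewrite bigcup_image.
  exists U => // l Q'l.
  by apply: (@shadow_sub _ _ _ _ p (s n)); exact: QnU (Q'l n).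
- exists [set A | exists n W, [/\ open W, Q n `<=` W & A = p (s n) @^-1` W]].
    by move=> _ [n [W [oW _ ->]]]; exact: limit_open.
  apply/seteqP; split=> [l Q'l _ [n [W [_ QW ->]]]|l Ql n].
    exact/QW/Q'l.
  have [_ [F Fo QF]] := Qcs n; rewrite QF => W FW.
  apply: (Ql (p (s n) @^-1` W)); exists n, W; split=> //; first exact: Fo.
  by rewrite QF => x; exact.
Qed.

Lemma increasing_shadow U : increasing (fun n => shadow p (s n) U).
Proof.
split=> [n|m n mn]; first exact: open_shadow.
exact: shadow_map.
Qed.

Lemma bigcup_shadow U : open U ->
  U = \bigcup_n (p (s n) @^-1` shadow p (s n) U).
Proof.
move=> oU; apply/seteqP; split=> [l Ul|l [n _ /shadow_sub//]].
have [i [A [oA Al AU]]] := limit_base hL oU Ul.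
have [n in_] := scof i; exists n => //=.
apply: (shadow_map hL in_); rewrite /= (limit_map hL).
exact: (@sub_shadow _ _ _ _ _ _ _ A).
Qed.

Lemma increasing_le V : increasing V ->
  forall m n, (m <= n)%N -> (nu (s m) (V m) <= nu (s n) (V n))%E.
Proof.
move=> [Vo Vmap] m n mn; rewrite -(hnu.2 _ _ (smono mn)) //.
apply: (valuation_le (hnu.1 _)) => //.
by apply: open_comp => // x _; exact: ps_continuous.
Qed.

(* Any presentation of U as an increasing union computes its valuation, not
   only the one by the shadows of U: this is where tightness is used. *)
Lemma limit_valuationE V : increasing V ->
  limit_valuation (\bigcup_n (p (s n) @^-1` V n)) =
  ereal_sup (range (fun n => nu (s n) (V n))).
Proof.
move=> Vincr; set U := \bigcup_n _; apply/le_anti/andP; split.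
- apply: ge_ereal_sup => _ [n _ <-]; rewrite leNgt; apply/negP => lt.
  have [Q [_ QU QV]] := limit_compact (open_shadow _ _ _) lt.
  have [|k] := QV _ Vincr; first by move=> l /QU /shadow_sub.
  apply/negP; rewrite -leNgt; apply: ereal_sup_ubound.
  by exists k.
- apply: ge_ereal_sup => _ [n _ <-].
  apply: (@le_trans _ _ (nu (s n) (shadow p (s n) U))); last first.
    by apply: ereal_sup_ubound; exists n.
  apply: (valuation_le (hnu.1 _)); [exact: Vincr.1|exact: open_shadow|].
  by apply: sub_shadow; [exact: Vincr.1|move=> l Vl; exists n].
Qed.

Lemma limit_valuation_cvg V : increasing V ->
  nu (s n) (V n) @[n --> \oo] -->
    limit_valuation (\bigcup_n (p (s n) @^-1` V n)).
Proof.
move=> Vincr; rewrite limit_valuationE //.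
by apply: ereal_nondecreasing_cvgn => m n; exact: increasing_le.
Qed.

Lemma limit_valuation_image i :
  eq_on_open (nu i) (image_valuation (p i) limit_valuation).
Proof.
move=> V oV; rewrite /image_valuation.
(* The existential, unlike the universal in [cylinder], gives the empty set at stages not above [i],
   which keeps the sequence increasing. *)
pose V' n := [set x | exists in_ : (i <= s n)%O, V (ps_map in_ x)].
have V'E n (in_ : (i <= s n)%O) : V' n = ps_map in_ @^-1` V.
  apply/seteqP; split=> [x [in_']|x Vx]; last by exists in_.
  by rewrite (bool_irrelevance in_' in_).
have oV' n : open (V' n).
  have [in_|nin] := pselect (i <= s n)%O.
    by rewrite (V'E n in_); apply: open_comp => // x _; exact: ps_continuous.
  rewrite (_ : V' n = set0); first exact: open0.
  by apply/seteqP; split=> // x [].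
have V'incr : increasing V'.
  split=> // m n mn x [im /= Vx]; exists (le_trans im (smono mn)).
  by rewrite -(ps_map_comp im (smono mn)).
have -> : p i @^-1` V = \bigcup_n (p (s n) @^-1` V' n).
  apply/seteqP; split=> l.
    have [n in_] := scof i; move=> Vl; exists n => //; exists in_.
    by rewrite (limit_map hL).
  by move=> [n _ [in_]]; rewrite (limit_map hL).
rewrite limit_valuationE //; apply/le_anti/andP; split.
- have [n in_] := scof i; apply: ereal_sup_ubound; exists n => //.
  by rewrite (V'E n in_); exact: hnu.2.
- apply: ge_ereal_sup => _ [n _ <-].
  have [in_|nin] := pselect (i <= s n)%O.
    by rewrite (V'E n in_) -(hnu.2 _ _ in_).
  rewrite (_ : V' n = set0); last by apply/seteqP; split=> // x [].
  have [[_ -> _ _] _] := hnu.1 (s n).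
  by have [[+ _ _ _] _] := hnu.1 i; exact.
Qed.

Lemma limit_valuation_le U U' : U `<=` U' ->
  (limit_valuation U <= limit_valuation U')%E.
Proof.
move=> UU'; apply: ge_ereal_sup => _ [n _ <-].
apply: (@le_trans _ _ (nu (s n) (shadow p (s n) U'))); last first.
  by apply: ereal_sup_ubound; exists n.
by apply: (valuation_le (hnu.1 _)); [exact: open_shadow..|exact: shadowS].
Qed.

Lemma limit_valuation_ge0 U : (0 <= limit_valuation U)%E.
Proof.
apply: (@le_trans _ _ (nu (s 0) (shadow p (s 0) U))).
  by have [[+ _ _ _] _] := hnu.1 (s 0); apply; exact: open_shadow.
by apply: ereal_sup_ubound; exists 0.
Qed.

Lemma limit_valuation_valuation : valuation limit_valuation.
Proof.
split=> [U _||U U' _ _|U U' oU oU'].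
- exact: limit_valuation_ge0.
- have [[i _] _] := ps_directed X.
  rewrite -(preimage_set0 (p i)) -[LHS]limit_valuation_image; last exact: open0.
  by have [[_ -> _ _] _] := hnu.1 i.
- exact: limit_valuation_le.
- have Uc := limit_valuation_cvg (increasing_shadow U).
  have U'c := limit_valuation_cvg (increasing_shadow U').
  have Ic := limit_valuation_cvg (increasing_shadow (U `&` U')).
  rewrite -!bigcup_shadow // in Uc U'c Ic; last exact: openI.
  (* The union of the shadows may be smaller than the shadow of the union, but it presents the same
     open set. Modularity then passes to the limit stage by stage, the sums being defined since all
     values are nonnegative. *)
  have incr : increasing (fun n => shadow p (s n) U `|` shadow p (s n) U').
    split=> [n|m n mn x [Ux|U'x]]; first by apply: openU; exact: open_shadow.
      by left; exact: (shadow_map hL (smono mn)).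
    by right; exact: (shadow_map hL (smono mn)).
  have := limit_valuation_cvg incr.
  rewrite (_ : \bigcup_n _ = U `|` U') => [Vc|]; last first.
    rewrite [in RHS](bigcup_shadow oU) [in RHS](bigcup_shadow oU').
    by rewrite -bigcupU; apply: eq_bigcupr => n _; rewrite preimage_setU.
  have add a b := @ge0_adde_def R (limit_valuation a) (limit_valuation b)
    (limit_valuation_ge0 a) (limit_valuation_ge0 b).
  have sum1 := cvgeD (FF := eventually_filter) (add _ _) Vc Ic.
  have sum2 := cvgeD (FF := eventually_filter) (add _ _) Uc U'c.
  rewrite -(cvg_lim (@ereal_hausdorff R) sum1).
  rewrite -(cvg_lim (@ereal_hausdorff R) sum2).
  congr (lim (_ @ \oo)); apply/funext => n /=.
  rewrite shadowI; have [[_ _ _ +] _] := hnu.1 (s n).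
  by apply; exact: open_shadow.
Qed.

Lemma limit_valuation_continuous : continuous_valuation limit_valuation.
Proof.
split=> [|F Fo [[U0 FU0] Fdir]]; first exact: limit_valuation_valuation.
(* With this presentation of the union, continuity of each [nu (s n)] reduces the claim to an
   exchange of suprema. *)
pose V n := \bigcup_(U in F) shadow p (s n) U.
have Vincr : increasing V.
  split=> [n|m n mn x [U FU Ux]].
    by apply: bigcup_open => U _; exact: open_shadow.
  by exists U => //; exact: (shadow_map hL (smono mn)).
have -> : \bigcup_(U in F) U = \bigcup_n (p (s n) @^-1` V n).
  apply/seteqP; split=> [l [U FU]|l [n _ [U FU /shadow_sub Ul]]].
    by rewrite (bigcup_shadow (Fo _ FU)) => -[n _ Ul]; exists n => //; exists U.
  by exists U.
rewrite limit_valuationE //; apply/le_anti/andP; split.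
- apply: ge_ereal_sup => _ [n _ <-]; rewrite /V.
  rewrite -(bigcup_image F (shadow p (s n)) id) (hnu.1 _).2.
  + apply: ge_ereal_sup => _ [_ [U FU <-] <-].
    apply: (@le_trans _ _ (limit_valuation U)).
      by apply: ereal_sup_ubound; exists n.
    by apply: ereal_sup_ubound; exists U.
  + by move=> _ [U _ <-]; exact: open_shadow.
  + split; first by exists (shadow p (s n) U0), U0.
    move=> _ _ [U FU <-] [U' FU' <-]; have [W FW [UW U'W]] := Fdir _ _ FU FU'.
    by exists (shadow p (s n) W); [exists W|split; exact: shadowS].
- apply: ge_ereal_sup => _ [U FU <-]; apply: ge_ereal_sup => _ [n _ <-].
  apply: (@le_trans _ _ (nu (s n) (V n))); last first.
    by apply: ereal_sup_ubound; exists n.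
  apply: (valuation_le (hnu.1 _)); [exact: open_shadow|exact: Vincr.1|].
  by move=> x Ux; exists U.
Qed.

(** An open set is the increasing union of the preimages of its shadows, on which [mu] is
    prescribed. *)
Lemma limit_valuation_unique mu : continuous_valuation mu ->
  (forall i, eq_on_open (nu i) (image_valuation (p i) mu)) ->
  eq_on_open mu limit_valuation.
Proof.
move=> muc mup U oU; rewrite [in LHS](bigcup_shadow oU).
rewrite -(bigcup_image setT (fun n => p (s n) @^-1` shadow p (s n) U) id) muc.2.
- rewrite image_comp; congr ereal_sup; apply: eq_imagel => n _ /=.
  by rewrite -[RHS]/(_ _) (mup (s n)) //; exact: open_shadow.
- by move=> _ [n _ <-]; apply: (limit_open hL); exact: open_shadow.
- split; first by exists (p (s 0) @^-1` shadow p (s 0) U), 0.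
  have le m n : (m <= n)%N ->
      p (s m) @^-1` shadow p (s m) U `<=` p (s n) @^-1` shadow p (s n) U.
    move=> mn; rewrite -(limit_preimage hL (smono mn)).
    by apply: preimage_subset; exact: shadow_map.
  move=> _ _ [m _ <-] [n _ <-]; exists (p (s (maxn m n)) @^-1` shadow p _ U).
    by exists (maxn m n).
  by split; apply: le; [exact: leq_maxl|exact: leq_maxr].
Qed.

Lemma limit_valuation_tight : tight limit_valuation.
Proof.
move=> U oU r r0 [->|rU].
  (* For [r = 0] no stage need exceed [r], and the empty compact set suffices. *)
  exists set0; split=> //; last first.
    by apply: le_ereal_inf_tmp => _ [V _ <-]; exact: limit_valuation_ge0.
  split; first exact: compact0.
  by exists [set set0]; [move=> _ ->; exact: open0|rewrite bigcap_set1].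
have [_ [n _ <-] rn] := ereal_sup_gt rU.
(* Every open [V] around this [Q] is presented by its own shadows, one of which must have valuation
   above [r]. *)
have [Q [cQ QU QV]] := limit_compact (open_shadow _ _ _) rn.
exists Q; split=> //; first by move=> l /QU /shadow_sub.
apply: le_ereal_inf_tmp => _ [V [oV QsubV] <-].
have [|k rk] := QV _ (increasing_shadow V); first by rewrite -bigcup_shadow.
by apply: le_trans (ltW rk) _; apply: ereal_sup_ubound; exists k.
Qed.

End LimitValuation.

Theorem theorem9p4 (R : realType) (d : Order.disp_t) (I : preorderType d)
    (X : projective_system I) (nu : forall i : I, set (X i) -> \bar R)
    (hnu : valued_system nu)
    (L : topologicalType) (p : forall i : I, L -> X i)
    (hL : projective_limit p)
    (hI : has_countable_cofinal I)
    (hfin : forall i : I, locally_finite (nu i))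
    (hemb : forall i : I, embeds_as_Gdelta (X i)) :
  exists mu : set L -> \bar R,
    [/\ continuous_valuation mu,
        forall i : I, eq_on_open (nu i) (image_valuation (p i) mu),
        forall mu' : set L -> \bar R, continuous_valuation mu' ->
          (forall i : I, eq_on_open (nu i) (image_valuation (p i) mu')) ->
          eq_on_open mu' mu &
        tight mu].
Proof.
have [s [smono scof]] := cofinal_sequence (ps_directed X) hI.
exists (limit_valuation nu p s); split.
- exact: limit_valuation_continuous.
- exact: limit_valuation_image.
- by move=> mu' mu'c mu'p; exact: limit_valuation_unique.
- exact: limit_valuation_tight.
Qed.
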